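(* Let $n\ge2$ be an integer, $G=\mathfrak S_{n+1}$ and $\lambda=(2,1^{n-1})$. Then $L^\lambda\cong L(n+1)$ as $\mathbf{Z}G$-modules.
   Context: Let $V$ be the $n$-dimensional absolutely irreducible $\mathbf{Q}G$-module (the Specht module $S^{\lambda}$ over $\mathbf{Q}$ for $\lambda=(2,1^{n-1})$) with $\mathbf{Q}$-basis $(e_1,\dots,e_n)$ on which, for $1\le k\le n$, the transposition $(k\ \,k+1)$ acts by left multiplication of coordinate column vectors by the matrix $E^{k,k-1}+2E^{k,k}+E^{k,k+1}-I_n$. Here $E^{i,j}$ is the $n\times n$ matrix with a single $1$ in position $(i,j)$, and $E^{i,j}=0$ if $i$ or $j$ is not in $\{1,\dots,n\}$. Equivalently, $(k\ \,k+1)\,e_j = -e_j + c_{kj}e_k$ with $c_{kj}=2$ if $j=k$, $c_{kj}=1$ if $|j-k|=1$, and $c_{kj}=0$ otherwise. Put $v = e_n + \sum_{i=1}^{n-1}(-1)^{n+1-i}\, i\, e_i$ and, for every integer $d>0$, $L(d) = \bigl(\bigoplus_{i=1}^{n-1}\mathbf{Z}\,d e_i\bigr)\oplus \mathbf{Z}v \subseteq V$. It is known (Craig) that for $d\mid n+1$ the module $L(d)$ is a $\mathbf{Z}G$-lattice of $V$. The Specht module $S^\lambda$ over $\mathbf{Q}$ has the Specht basis $(e_T)_T$ indexed by the standard Young tableaux $T$ of shape $\lambda$; here $e_T=\sum_{\pi\in C_T}\operatorname{sgn}(\pi)\,\pi\{T\}$ is the polytabloid of $T$, with $\{T\}$ the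 tabloid (row equivalence class) of $T$ and $C_T$ the column stabilizer of $T$. The representation matrices with respect to this basis are integral, and the Specht lattice is the $\mathbf{Z}G$-lattice $L^\lambda=\bigoplus_T \mathbf{Z}e_T$. *)

(* Defs.v *)
From HB Require Import structures.
From mathcomp Require Import all_boot all_order all_algebra.
From mathcomp Require Import all_fingroup all_character.
From mathcomp Require Import zify ring.

Set Implicit Arguments.
Unset Strict Implicit.
Unset Printing Implicit Defensive.

Import GRing.Theory.
Local Open Scope ring_scope.

(* In MathComp (s * t)%g is "first s, then t", i.e. the composite t \o s.
   Hence a left module over the group of permutations under composition is a
   family of maps a : {perm T} -> U -> U with a (s * t)%g u = a t (a s u);
   matrix representations accordingly act on the right of row vectors. *)

Section ZGModules.
Variables (gT : finGroupType) (U W : zmodType).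

(* U and W are ambient additive groups on which gT acts through aU and aW; a
   ZG-lattice is given by its carrier inside the ambient group. *)
Definition ZG_stable (M : zmodType) (a : gT -> M -> M) (L : M -> Prop) : Prop :=
  forall g x, L x -> L (a g x).

Definition ZG_isomorphic (aU : gT -> U -> U) (L : U -> Prop)
    (aW : gT -> W -> W) (L' : W -> Prop) : Prop :=
  [/\ ZG_stable aU L, ZG_stable aW L' &
      exists f : U -> W,
        [/\ forall x, L x -> L' (f x),
            forall x y, L x -> L y -> f (x + y) = f x + f y,
            forall x y, L x -> L y -> f x = f y -> x = y,
            forall y, L' y -> exists2 x, L x & f x = y
          & forall g x, L x -> f (aU g x) = aW g (f x)]].

End ZGModules.

Section SpechtLattice.
(* sh is the partition lambda, as its sequence of parts; the entries of the
   tableaux are 0, ..., N - 1 instead of 1, ..., N, where N = sumn sh. *)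
Variables (N : nat) (sh : seq nat).

Definition box : finType := {i : 'I_(size sh) & 'I_(nth 0%N sh i)}.
Definition box_row (b : box) : nat := tag b.
Definition box_col (b : box) : nat := tagged b.

Definition is_tableau (T : {ffun box -> 'I_N}) : bool :=
  injectiveb T && [forall i, i \in codom T].

Definition tableau : finType := {T : {ffun box -> 'I_N} | is_tableau T}.

Definition entry (T : tableau) (b : box) : 'I_N := val T b.

Lemma tableau_act_proof (p : {perm 'I_N}) (T : tableau) :
  is_tableau [ffun b => p (entry T b)].
Proof.
have /andP[/injectiveP injT /forallP surjT] := valP T.
apply/andP; split; first by apply/injectiveP => b c; rewrite !ffunE => /perm_inj/injT.
apply/forallP => i; have /codomP[b bE] := surjT (p^-1%g i).
by apply/codomP; exists b; rewrite ffunE /entry -bE permKV.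
Qed.

Definition tableau_act (p : {perm 'I_N}) (T : tableau) : tableau :=
  Sub [ffun b => p (entry T b)] (tableau_act_proof p T).

Definition standard (T : tableau) : bool :=
  [forall b, forall c,
     ((box_row b == box_row c) && (box_col b < box_col c)%N
        ==> (entry T b < entry T c)%N)
  && ((box_col b == box_col c) && (box_row b < box_row c)%N
        ==> (entry T b < entry T c)%N)].

Definition row_content (T : tableau) (i : nat) : {set 'I_N} :=
  [set entry T b | b : box & box_row b == i].

Definition row_equiv (T T' : tableau) : bool :=
  [forall i : 'I_(size sh), row_content T i == row_content T' i].

Definition row_class (T : tableau) : {set tableau} :=
  [set T' | row_equiv T T'].

Definition tabloid : finType :=
  {X : {set tableau} | X \in [set row_class T | T : tableau]}.

Lemma tabloid_of_proof (T : tableau) :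
  row_class T \in [set row_class T | T : tableau].
Proof. exact: imset_f. Qed.

Definition tabloid_of (T : tableau) : tabloid := Sub (row_class T) (tabloid_of_proof T).

Lemma row_content_act p T i :
  row_content (tableau_act p T) i = p @: row_content T i.
Proof.
rewrite /row_content -imset_comp; apply: eq_imset => b.
by rewrite /entry SubK ffunE.
Qed.

Lemma row_equiv_act p T T' :
  row_equiv (tableau_act p T) (tableau_act p T') = row_equiv T T'.
Proof.
apply: eq_forallb => i; rewrite !row_content_act.
by rewrite (inj_eq (imset_inj (@perm_inj _ p))).
Qed.

Lemma tableau_actK p : cancel (tableau_act p) (tableau_act p^-1%g).
Proof.
by move=> T; apply/val_inj/ffunP => b; rewrite SubK ffunE /entry SubK ffunE permK.
Qed.

Lemma tabloid_act_proof (p : {perm 'I_N}) (X : tabloid) :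
  tableau_act p @: val X \in [set row_class T | T : tableau].
Proof.
have /imsetP[T _ ->] := valP X; apply/imsetP; exists (tableau_act p T) => //.
apply/setP => T'; rewrite inE; apply/imsetP/idP => [[T1]|TT'].
  by rewrite inE => TT1 ->; rewrite row_equiv_act.
exists (tableau_act p^-1%g T'); last by rewrite -{1}[p]invgK tableau_actK.
by rewrite inE -(row_equiv_act p) -{2}[p]invgK tableau_actK.
Qed.

Definition tabloid_act (p : {perm 'I_N}) (X : tabloid) : tabloid :=
  Sub (tableau_act p @: val X) (tabloid_act_proof p X).

Lemma tabloid_act_of p T :
  tabloid_act p (tabloid_of T) = tabloid_of (tableau_act p T).
Proof.
apply/val_inj/setP => T'; rewrite /= inE; apply/imsetP/idP => [[T1]|TT'].
  by rewrite inE => TT1 ->; rewrite row_equiv_act.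
exists (tableau_act p^-1%g T'); last by rewrite -{1}[p]invgK tableau_actK.
by rewrite inE -(row_equiv_act p) -{2}[p]invgK tableau_actK.
Qed.

(* {ffun tabloid -> rat^o} is the permutation module over Q with the tabloids as
   basis. *)
Definition tabloid_vec (X : tabloid) : {ffun tabloid -> rat^o} :=
  [ffun Y => (Y == X)%:R].

Definition tabloid_module_act (p : {perm 'I_N}) (u : {ffun tabloid -> rat^o}) :
    {ffun tabloid -> rat^o} :=
  \sum_X u X *: tabloid_vec (tabloid_act p X).

Definition column_stab (T : tableau) : {set {perm 'I_N}} :=
  [set p : {perm 'I_N} | [forall b, exists c,
              (box_col c == box_col b) && (p (entry T b) == entry T c)]].

Definition polytabloid (T : tableau) : {ffun tabloid -> rat^o} :=
  \sum_(p in column_stab T)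
     (-1) ^+ p *: tabloid_vec (tabloid_act p (tabloid_of T)).

(* The standard polytabloids being a basis of the Specht module, the direct
   sum of the lines they span over Z is their Z-span. *)
Definition specht_lattice (u : {ffun tabloid -> rat^o}) : Prop :=
  inIntSpan (in_tuple [seq polytabloid T | T <- enum tableau & standard T]) u.

End SpechtLattice.

Section CraigLattice.
Variable n : nat.

Definition hook : seq nat := 2%N :: nseq n.-1 1%N.

(* Indices are 1-based here: i, j, k range over 1, ..., n, and elem_mx i j
   and basis_vec i vanish when an index is out of range. *)
Definition elem_mx (i j : nat) : 'M[rat]_n :=
  \matrix_(a, b) ((a.+1 == i) && (b.+1 == j))%:R.

Definition basis_vec (i : nat) : 'rV[rat]_n := \row_a (a.+1 == i)%:R.

(* The transposition (k k+1) of {1, ..., n+1}, i.e. (k-1 k) on 'I_n.+1. *)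
Definition adj_tperm (k : nat) : 'S_n.+1 := tperm (inord k.-1) (inord k).

Definition adj_mx (k : nat) : 'M[rat]_n :=
  elem_mx k k.-1 + 2 *: elem_mx k k + elem_mx k k.+1 - 1%:M.

(* The matrices adj_mx k act on the left of column vectors; the representation
   rG acts on the right of row vectors, whence the transpose. *)
Definition craig_repr (rG : mx_representation rat [set: 'S_n.+1] n) : Prop :=
  forall k, (1 <= k <= n)%N -> rG (adj_tperm k) = (adj_mx k)^T.

Definition craig_act (rG : mx_representation rat [set: 'S_n.+1] n)
  (g : 'S_n.+1) (x : 'rV[rat]_n) : 'rV[rat]_n := x *m rG g.

Definition craig_v : 'rV[rat]_n :=
  basis_vec n + \sum_(1 <= i < n) ((-1) ^+ (n.+1 - i) * i%:R) *: basis_vec i.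

Definition craig_lattice (d : nat) (x : 'rV[rat]_n) : Prop :=
  inIntSpan (in_tuple (rcons [seq d%:R *: basis_vec i | i <- iota 1 n.-1] craig_v)) x.

(* Such a representation exists; it is the sign character tensored with the
   root lattice of type A_n, with (-1) ^+ i times the i-th simple root as basis
   vectors.  It is unique as the adj_tperm k generate the symmetric group. *)
Lemma craig_repr_exists : exists rG, craig_repr rG.
Proof.
pose B : 'M[rat]_(n, n.+1) :=
  \matrix_(i, a) ((-1) ^+ i * ((a == i :> nat)%:R - (a == i.+1 :> nat)%:R)).
pose C : 'M[rat]_(n.+1, n) := \matrix_(a, i) ((a <= i)%N%:R * (-1) ^+ i).
pose r (g : 'S_n.+1) : 'M[rat]_n := (-1) ^+ g *: (B *m perm_mx g *m C).
have sumB i (F : 'I_n.+1 -> rat) : \sum_a B i a * F a =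
    (-1) ^+ i * (F (widen_ord (leqnSn n) i) - F (lift ord0 i)).
  have ne : lift ord0 i != widen_ord (leqnSn n) i.
    by rewrite -val_eqE /= /bump /= add1n neq_ltn ltnSn orbT.
  rewrite (bigD1 (widen_ord (leqnSn n) i)) //= (bigD1 (lift ord0 i)) //=.
  rewrite big1 => [|a /andP[na1 na2]]; last first.
    by rewrite mxE; move: na1 na2; rewrite -!val_eqE /= /bump /= add1n =>
      /negPf-> /negPf->; rewrite subrr mulr0 mul0r.
  rewrite !mxE /= /bump /= !add1n !eqxx addr0 (gtn_eqF (ltnSn i)).
  by rewrite (ltn_eqF (ltnSn i)) subr0 sub0r mulr1 mulrN1 mulNr mulrBr.
have rE g i j : r g i j = (-1) ^+ g * ((-1) ^+ i * (-1) ^+ j *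
    ((g (widen_ord (leqnSn n) i) <= j)%N%:R - (g (lift ord0 i) <= j)%N%:R))
    :> rat.
  rewrite /r mxE; congr (_ * _).
  have -> : B *m perm_mx g *m C = B *m (row_perm g C).
    by rewrite -mulmxA -row_permE.
  rewrite mxE sumB !mxE -mulrBl; ring.
have CB : C *m B = 1%:M - \matrix_(a, b) (b == n :> nat)%:R.
  apply/matrixP => a b; rewrite !mxE.
  have -> : \sum_j C a j * B j b =
      \sum_(j < n) (a <= j)%N%:R * ((b == j :> nat)%:R - (b == j.+1 :> nat)%:R).
    apply: eq_bigr => j _; rewrite !mxE mulrA -[_ * _ * (-1) ^+ _]mulrA.
    by rewrite -exprD addnn -mul2n exprM sqrrN !expr1n mulr1.
  rewrite (eq_bigr (fun j : 'I_n => (if b == j :> nat then (a <= j)%N%:R else 0)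
      - (if b == j.+1 :> nat then (a <= j)%N%:R else 0))); last first.
    by move=> j _; do 2!case: eqP => _; rewrite ?mulrBr ?mulr1 ?mulr0.
  rewrite sumrB -!big_mkcond /=.
  have -> : \sum_(j < n | b == j :> nat) (a <= j)%N%:R
      = ((b < n) && (a <= b))%N%:R :> rat.
    case: ltnP => bn /=.
      by rewrite (big_pred1 (Ordinal bn)).
    by rewrite big_pred0 // => j; apply/negP => /eqP bj; move: (ltn_ord j); lia.
  have -> : \sum_(j < n | b == j.+1 :> nat) (a <= j)%N%:R = (a < b)%N%:R :> rat.
    have [b0|b0] := posnP b; first by rewrite big_pred0 b0.
    have bn : (b.-1 < n)%N by have := ltn_ord b; lia.
    rewrite (big_pred1 (Ordinal bn)) => [/=|j]; first by congr (nat_of_bool _)%:R; lia.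
    by rewrite -[RHS]/(j == b.-1 :> nat); lia.
  rewrite -val_eqE /=; have := ltn_ord a; have := ltn_ord b.
  case: (ltngtP a b) => [?|?|->]; case: (ltngtP b n) => [?|?|bn] /= ? ?; rewrite ?leqnn ?ltnn /= ?subrr ?subr0 ?sub0r //; lia.
have BJ g : B *m perm_mx g *m (\matrix_(a < n.+1, b < n.+1) (b == n :> nat)%:R) = 0.
  rewrite -mulmxA -row_permE; apply/matrixP => i b.
  by rewrite mxE sumB !mxE subrr mulr0.
have r1 : r 1%g = 1%:M.
  apply/matrixP => i j; rewrite rE !perm1 odd_perm1 mul1r mxE /= /bump add1n.
  rewrite -val_eqE /=; case: ltngtP => [||->] //=; rewrite ?subrr ?mulr0 // subr0.
  by rewrite mulr1 -exprD addnn -mul2n exprM sqrrN !expr1n.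
have rM : {in [set: 'S_n.+1] &, {morph r : x y / (x * y)%g >-> x *m y}}.
  move=> g h _ _; rewrite /r -scalemxAl -scalemxAr scalerA odd_permM signr_addb.
  congr (_ *: _); rewrite perm_mxM !mulmxA -[_ *m C *m B]mulmxA CB mulmxBr mulmx1.
  by rewrite BJ subr0.
exists (MxRepresentation (conj r1 rM)) => k /andP[k1 kn] /=.
apply/matrixP => i j; rewrite rE odd_tperm.
have vk : (inord k : 'I_n.+1) = k :> nat by rewrite inordK.
have vk1 : (inord k.-1 : 'I_n.+1) = k.-1 :> nat by rewrite inordK //; lia.
have -> : (inord k.-1 : 'I_n.+1) != inord k by apply/eqP => /(congr1 (@nat_of_ord _)); rewrite vk vk1; lia.
have sE a : adj_tperm k a =
    (if a == k.-1 :> nat then k else if a == k :> nat then k.-1 else a) :> nat.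
  rewrite /adj_tperm; case: tpermP => [->|->|na1 na2].
  - by rewrite vk1 eqxx.
  - by rewrite vk eqxx; case: eqP => //; lia.
  - case: eqP => [ak|_]; first by case: na1; apply: val_inj; rewrite /= ak vk1.
    by case: eqP => [ak|//]; case: na2; apply: val_inj; rewrite /= ak vk.
rewrite !sE !mxE /= /bump /= add1n -val_eqE /= expr1.
have ni := ltn_ord i; have nj := ltn_ord j.
have sg m : (-1) ^+ m * (-1) ^+ m = 1 :> rat.
  by rewrite -exprD addnn -mul2n exprM sqrrN !expr1n.
have [ji|[ji|[ji|ji]]] :
    (j = i :> nat \/ j = i.+1 :> nat \/ i = j.+1 :> nat \/
     (i.+1 < j)%N || (j.+1 < i)%N)%type by lia.
- rewrite ji (sg i); do 4![case: eqP => ? //=; try lia];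
    do ?[case: leqP => ? //=; try lia]; rewrite ?eqxx /=;
    do ?[case: eqP => ? //=; try lia]; ring.
- rewrite ji exprS [(-1) ^+ i * _]mulrCA (sg i); do 4![case: eqP => ? //=; try lia];
    do ?[case: leqP => ? //=; try lia];
    do ?[case: eqP => ? //=; try lia]; ring.
- rewrite ji exprS -[_ * _ * (-1) ^+ j]mulrA (sg j); do 4![case: eqP => ? //=; try lia];
    do ?[case: leqP => ? //=; try lia];
    do ?[case: eqP => ? //=; try lia]; ring.
- do 4![case: eqP => ? //=; try lia];
    do ?[case: leqP => ? //=; try lia];
    do ?[case: eqP => ? //=; try lia]; ring.
Qed.

End CraigLattice.

(* Main.v *)
(* The first column of a tableau omits a single letter b, and polytabloids of tableaux
   with the same b agree up to sign.  Normalising signs gives vectors w_b, one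
   per letter, with g w_b = sgn(g) w_(g b) and sum_b w_b = 0 as only relation;
   their Z-span is the Specht lattice.  On the Craig side, the basis being
   e_i = (-1)^i (eps_i - eps_(i+1)) up to twisting by the sign, the vectors
   u_b = (n+1) eps_b - sum_c eps_c satisfy the same identities, and span
   L(n+1): one has (n+1) e_i = +- (u_b - u_b') for consecutive letters b and b',
   while v is, up to sign, the u_b of the last letter but one.  The isomorphism
   sends w_b to u_b. *)
Require Import Defs.
From HB Require Import structures.
From mathcomp Require Import all_boot all_order all_algebra.
From mathcomp Require Import all_fingroup all_character.
From mathcomp Require Import zify ring.

Set Implicit Arguments.
Unset Strict Implicit.
Unset Printing Implicit Defensive.

Import GRing.Theory Num.Theory.
Local Open Scope ring_scope.

(** * Integral spans and isomorphisms between them *)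

Lemma signrZ_mulrz (V : lmodType rat) (k : nat) (x : V) :
  (-1) ^+ k *: x = x *~ (-1) ^+ k.
Proof.
rewrite -[in LHS]signr_odd -[in RHS]signr_odd; case: (odd k).
  by rewrite !expr1 scaleN1r mulrN1z.
by rewrite scale1r.
Qed.

Section IntegralSpan.
Variables (I : finType) (V : zmodType) (w : I -> V).

(** Whereas [inIntSpan] takes a tuple, this form allows generators indexed by letters. *)
Definition zspan (x : V) : Prop := exists z : I -> int, x = \sum_i w i *~ z i.

Lemma zspan0 : zspan 0.
Proof. by exists (fun=> 0); rewrite big1 // => i _; rewrite mulr0z. Qed.

Lemma zspanD x y : zspan x -> zspan y -> zspan (x + y).
Proof.
move=> [a ->] [b ->]; exists (fun i => a i + b i).
by rewrite -big_split; apply: eq_bigr => i _; rewrite mulrzDr.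
Qed.

Lemma zspanMz x k : zspan x -> zspan (x *~ k).
Proof.
move=> [a ->]; exists (fun i => a i * k); rewrite mulrz_suml.
by apply: eq_bigr => i _; rewrite mulrzA.
Qed.

Lemma zspan_gen i : zspan (w i).
Proof.
exists (fun j => (j == i)%:R); rewrite (bigD1 i) //= eqxx big1 ?addr0 //.
by move=> j /negPf->.
Qed.

Lemma zspan_sum (J : finType) (P : pred J) F :
  (forall j, P j -> zspan (F j)) -> zspan (\sum_(j | P j) F j).
Proof. by move=> FP; apply: big_ind => //; [apply: zspan0 | apply: zspanD]. Qed.

End IntegralSpan.

Lemma inIntSpan_seqP (V : zmodType) (s : seq V) (x : V) :
  inIntSpan (in_tuple s) x <-> zspan (fun i : 'I_(size s) => s`_i) x.
Proof.
split=> [[a ->]|[a ->]]; first by exists a.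
by exists [ffun i => a i]; apply: eq_bigr => i _; rewrite ffunE.
Qed.

Lemma inIntSpan_zspan (I : finType) (V : zmodType) (s : seq V) (w : I -> V) :
    (forall y, y \in s -> zspan w y) ->
    (forall i, inIntSpan (in_tuple s) (w i)) ->
  forall x, inIntSpan (in_tuple s) x <-> zspan w x.
Proof.
move=> sw ws x; split=> [/inIntSpan_seqP[a ->]|[a ->]].
  by apply: zspan_sum => i _; apply/zspanMz/sw/mem_nth.
apply/inIntSpan_seqP/zspan_sum => i _; apply: zspanMz.
exact/inIntSpan_seqP.
Qed.

Lemma inIntSpan_mem (V : zmodType) (s : seq V) y :
  y \in s -> inIntSpan (in_tuple s) y.
Proof.
move=> ys; apply/inIntSpan_seqP; have ys' := ys; rewrite -index_mem in ys'.
by have := zspan_gen (fun i : 'I_(size s) => s`_i) (Ordinal ys'); rewrite /= nth_index.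
Qed.

(** Both actions move the generators through the same [p] with the same factors [s], so every clause
    but injectivity follows from its case on generators; injectivity is the kernel condition. *)
Lemma ZG_isomorphic_zspan (gT : finGroupType) (I : finType) (U W : zmodType)
    (aU : gT -> U -> U) (aW : gT -> W -> W) (L : U -> Prop) (L' : W -> Prop)
    (w : I -> U) (u : I -> W) (p : gT -> I -> I) (s : gT -> int) (f : U -> W) :
    (forall x, L x <-> zspan w x) -> (forall y, L' y <-> zspan u y) ->
    (forall g, zmod_morphism (aU g)) -> (forall g, zmod_morphism (aW g)) ->
    (forall g i, aU g (w i) = w (p g i) *~ s g) ->
    (forall g i, aW g (u i) = u (p g i) *~ s g) ->
    zmod_morphism f -> (forall i, f (w i) = u i) ->
    (forall x, L x -> f x = 0 -> x = 0) ->
  ZG_isomorphic aU L aW L'.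
Proof.
move=> Lw L'u aUB aWB aUw aWu fB fw f0.
pose F : {additive U -> W} := HB.pack f (GRing.isZmodMorphism.Build U W f fB).
pose AU g : {additive U -> U} :=
  HB.pack (aU g) (GRing.isZmodMorphism.Build U U (aU g) (aUB g)).
pose AW g : {additive W -> W} :=
  HB.pack (aW g) (GRing.isZmodMorphism.Build W W (aW g) (aWB g)).
have aU_sum g z : aU g (\sum_i w i *~ z i) = \sum_i (w (p g i) *~ s g) *~ z i.
  rewrite -[LHS]/(AU g _) raddf_sum; apply: eq_bigr => i _.
  by rewrite raddfMz -aUw.
have aW_sum g z : aW g (\sum_i u i *~ z i) = \sum_i (u (p g i) *~ s g) *~ z i.
  rewrite -[LHS]/(AW g _) raddf_sum; apply: eq_bigr => i _.
  by rewrite raddfMz -aWu.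
have f_sum z : f (\sum_i w i *~ z i) = \sum_i u i *~ z i.
  rewrite -[LHS]/(F _) raddf_sum; apply: eq_bigr => i _.
  by rewrite raddfMz -fw.
split=> [g x /Lw[z ->]|g x /L'u[z ->]|].
- apply/Lw; rewrite aU_sum; apply: zspan_sum => i _.
  by do 2!apply: zspanMz; apply: zspan_gen.
- apply/L'u; rewrite aW_sum; apply: zspan_sum => i _.
  by do 2!apply: zspanMz; apply: zspan_gen.
exists f; split.
- by move=> x /Lw[z ->]; apply/L'u; exists z.
- by move=> x y _ _; apply: (raddfD F).
- move=> x y /Lw Lx /Lw Ly fxy; apply/eqP; rewrite -subr_eq0; apply/eqP/f0.
    by apply/Lw/zspanD => //; rewrite -mulrN1z; apply: zspanMz.
  by rewrite fB fxy subrr.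
- by move=> y /L'u[z ->]; exists (\sum_i w i *~ z i); [apply/Lw; exists z | ].
- move=> g x /Lw[z ->]; rewrite f_sum aU_sum aW_sum -[LHS]/(F _) raddf_sum.
  by apply: eq_bigr => i _; rewrite !raddfMz -fw.
Qed.

(** * Tableaux, polytabloids and the Specht lattice of hook shape *)

Section HookTableaux.
Variable n : nat.
Hypothesis n_gt0 : (0 < n)%N.

Local Notation box := (box (hook n)).
Local Notation tableau := (tableau n.+1 (hook n)).
Local Notation tabloid := (tabloid n.+1 (hook n)).

(** This numbers the only box outside the first column, so [word T i1] is the letter that the first
    column omits. *)
Let i1 : 'I_n.+1 := inord 1.

Let val_i1 : i1 = 1%N :> nat. Proof. by rewrite inordK. Qed.

Let i1_neq0 : i1 != ord0. Proof. by rewrite -val_eqE /= val_i1. Qed.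

Lemma size_hook : size (hook n) = n.
Proof. by rewrite /= size_nseq prednK. Qed.

Lemma nth_hook i : (i < n)%N -> nth 0%N (hook n) i = (i == 0%N).+1.
Proof. by case: i => [|i] //= lt_i; rewrite nth_nseq; case: ifP => //; lia. Qed.

Lemma box_row_lt (b : box) : (box_row b < n)%N.
Proof. by rewrite -[X in (_ < X)%N]size_hook; apply: ltn_ord. Qed.

Lemma box_col_le (b : box) : (box_col b <= (box_row b == 0%N))%N.
Proof. by rewrite -ltnS -nth_hook ?box_row_lt //; apply: ltn_ord. Qed.

Lemma box_inj (b c : box) : box_row b = box_row c -> box_col b = box_col c -> b = c.
Proof.
case: b c => [i j] [i' j']; rewrite /box_row /box_col /= => /val_inj ii'.
by move: j'; rewrite -{}ii' => j' /val_inj->.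
Qed.

Lemma box_exists i j : (i < n)%N -> (j <= (i == 0%N))%N ->
  exists b : box, box_row b = i /\ box_col b = j.
Proof.
move=> lt_in; rewrite -ltnS -(nth_hook lt_in) => lt_j.
rewrite -size_hook in lt_in.
by exists (Tagged (fun i : 'I_(size (hook n)) => 'I_(nth 0%N (hook n) i))
             (Ordinal lt_j : 'I_(nth 0%N (hook n) (Ordinal lt_in)))).
Qed.

(* The boxes are numbered 0 at the corner, 1 to its right, and 2, 3, ... down
   the first column. *)
Definition box_index (b : box) : 'I_n.+1 :=
  inord (box_row b + ((box_row b != 0%N) || (box_col b == 1%N))).

Lemma val_box_index b :
  box_index b = (box_row b + ((box_row b != 0%N) || (box_col b == 1%N)))%N :> nat.
Proof. by rewrite inordK //; have := box_row_lt b; lia. Qed.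

Lemma box_rowE b : box_row b = (box_index b).-1.
Proof. by have := box_col_le b; rewrite val_box_index; lia. Qed.

Lemma box_colE b : box_col b = (box_index b == i1).
Proof.
by have := box_col_le b; rewrite -val_eqE /= val_i1 val_box_index; lia.
Qed.

Lemma box_index_inj : injective box_index.
Proof. by move=> b c bc; apply: box_inj; rewrite ?box_rowE ?box_colE bc. Qed.

Lemma box_index_surj k : exists b, box_index b == k.
Proof.
have [||b [bi bj]] := @box_exists k.-1 (k == i1).
- by have := ltn_ord k; lia.
- by rewrite -val_eqE /= val_i1; lia.
exists b; rewrite -val_eqE /= val_box_index bi bj -val_eqE /= val_i1; lia.
Qed.

Definition index_box (k : 'I_n.+1) : box := xchoose (box_index_surj k).

Lemma index_boxK : cancel index_box box_index.
Proof. by move=> k; apply/eqP/(xchooseP (box_index_surj k)). Qed.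

Lemma box_indexK : cancel box_index index_box.
Proof. exact: inj_can_sym index_boxK box_index_inj. Qed.

Lemma word_proof (T : tableau) : injective (fun k => entry T (index_box k)).
Proof.
have /andP[/injectiveP injT _] := valP T.
exact: inj_comp injT (can_inj index_boxK).
Qed.

Definition word (T : tableau) : 'S_n.+1 := perm (@word_proof T).

Lemma entryE T b : entry T b = word T (box_index b).
Proof. by rewrite permE box_indexK. Qed.

Lemma of_word_proof (s : 'S_n.+1) :
  @is_tableau n.+1 (hook n) [ffun b => s (box_index b)].
Proof.
apply/andP; split.
  by apply/injectiveP => b c; rewrite !ffunE => /perm_inj/box_index_inj.
apply/forallP => k; apply/codomP; exists (index_box (s^-1%g k)).
by rewrite ffunE index_boxK permKV.
Qed.

Definition of_word (s : 'S_n.+1) : tableau := Sub _ (of_word_proof s).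

Lemma of_wordK : cancel of_word word.
Proof. by move=> s; apply/permP => k; rewrite permE /entry ffunE index_boxK. Qed.

Lemma word_act p T : word (tableau_act p T) = (word T * p)%g.
Proof. by apply/permP => k; rewrite permM !permE /entry SubK ffunE. Qed.

Lemma row_contentE T i :
  row_content T i = word T @: [set k : 'I_n.+1 | k.-1 == i].
Proof.
apply/setP => x; apply/imsetP/imsetP => [[b]|[k]]; rewrite inE => bi ->.
  by exists (box_index b); rewrite ?inE -?box_rowE ?entryE.
by exists (index_box k); rewrite ?inE ?box_rowE ?entryE index_boxK.
Qed.

(** Boxes 0 and 1 form the only row with two boxes, so swapping them is the only freedom inside a
    tabloid. *)
Lemma row_equivE T S :
  row_equiv T S = (word T == word S) || (word T == tperm ord0 i1 * word S)%g.
Proof.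
(* The predecessor sends both 0 and 1 to 0, so [k.-1] is the row of box [k]. *)
pose row i := [set k : 'I_n.+1 | k.-1 == i].
have tperm_row k : (tperm ord0 i1 k).-1 = k.-1.
  by case: tpermP => [->|->|] //; rewrite val_i1.
apply/forallP/orP => [eqTS|[/eqP TS|/eqP TS] i]; last first.
- rewrite !row_contentE TS; apply/eqP/setP => x; apply/imsetP/imsetP => -[k].
    by rewrite inE permM => ki ->; exists (tperm ord0 i1 k); rewrite ?inE ?tperm_row.
  rewrite inE => ki ->; exists (tperm ord0 i1 k); rewrite ?inE ?tperm_row //.
  by rewrite permM tpermK.
- by rewrite !row_contentE TS.
have rowq k : ((word S)^-1%g (word T k)).-1 = k.-1.
  have lt_k : (k.-1 < size (hook n))%N by rewrite size_hook; have := ltn_ord k; lia.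
  have /eqP := eqTS (Ordinal lt_k); rewrite !row_contentE /= => /setP/(_ (word T k)).
  rewrite imset_f ?inE // => /esym/imsetP[l]; rewrite inE => /eqP <- ->.
  by rewrite permK.
(* [q] sends a box of [T] to the box of [S] with the same entry; preserving rows, it fixes every box
   beyond 1. *)
set q := (word T * (word S)^-1)%g.
have {}rowq k : (q k).-1 = k.-1 by rewrite permM.
have qk (k : 'I_n.+1) : (1 < k)%N -> q k = k.
  by move=> k1; apply: val_inj; have /= := rowq k; lia.
have qv : (q ord0 = ord0 /\ q i1 = i1) \/ (q ord0 = i1 /\ q i1 = ord0).
  have : q ord0 != q i1 by rewrite (inj_eq perm_inj) eq_sym.
  have := rowq ord0; have := rowq i1; rewrite val_i1 -val_eqE /= => q1 q0 q01.
  have [q0E|q0E] : q ord0 = 0%N :> nat \/ q ord0 = 1%N :> nat by lia.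
    left; split; apply: val_inj; rewrite /= ?val_i1; lia.
  right; split; apply: val_inj; rewrite /= ?val_i1; lia.
have k_cases (k : 'I_n.+1) : [\/ k = ord0, k = i1 | (1 < k)%N].
  case: (ltnP 1 k) => [|k1]; first by constructor 3.
  have [k0|k0] := posnP k; first by constructor 1; apply: val_inj.
  by constructor 2; apply: val_inj; rewrite /= val_i1; lia.
have -> : word T = (q * word S)%g by rewrite mulgKV.
case: qv => -[q0 q1]; [left | right].
  suff -> : q = 1%g by rewrite mul1g.
  apply/permP => k; rewrite perm1.
  by have [->|->|/qk] := k_cases k.
suff -> : q = tperm ord0 i1 by [].
apply/permP => k; have [->|->|k1] := k_cases k.
- by rewrite tpermL.
- by rewrite tpermR.
- by rewrite qk // tpermD // -val_eqE /= ?val_i1; lia.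
Qed.

Lemma tabloid_of_eq (T S : tableau) :
  (tabloid_of T == tabloid_of S) =
  (word T == word S) || (word T == tperm ord0 i1 * word S)%g.
Proof.
rewrite -row_equivE -val_eqE /=; apply/eqP/idP => [TS|].
  have : S \in row_class S by rewrite inE; apply/forallP.
  by rewrite -TS inE.
move=> /forallP TS; apply/setP => T'; rewrite !inE.
by apply: eq_forallb => i; rewrite (eqP (TS i)).
Qed.

(** The second column is the single box [i1], and a permutation fixing its letter also preserves the
    set of remaining letters, which is the first column. *)
Lemma column_stabE T p : (p \in column_stab T) = (p (word T i1) == word T i1).
Proof.
rewrite inE; apply/forallP/eqP => [stabT|pT b].
  have /existsP[c /andP[]] := stabT (index_box i1).
  rewrite !entryE !box_colE !index_boxK eqxx => + /eqP ->.
  by case: (box_index c =P i1) => [->|].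
apply/existsP; exists (index_box ((word T)^-1%g (p (word T (box_index b))))).
rewrite !entryE !box_colE index_boxK permKV eqxx andbT -(inj_eq (@perm_inj _ (word T))).
by rewrite permKV -{1}pT !(inj_eq perm_inj).
Qed.

(** Only [q1] and [q2] carry the tabloid of [T] to that of [S]. They differ by the swap of the first
    row, hence have opposite signs, and each bracketed term tests whether one of them stabilizes the
    columns of [T]. *)
Lemma polytabloidE T S :
  polytabloid T (tabloid_of S) =
    (-1) ^+ word T * (-1) ^+ word S *
    ((word T i1 == word S i1)%:R - (word T i1 == word S ord0)%:R).
Proof.
have sum_at q : \sum_(p in column_stab T) (-1) ^+ p * (p == q)%:R =
    (-1) ^+ q * (q (word T i1) == word T i1)%:R :> rat.
  rewrite big_mkcond (bigD1 q) //= eqxx column_stabE big1 ?addr0 => [|p /negPf->].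
    by case: eqP; rewrite ?mulr1 ?mulr0.
  by rewrite mulr0 if_same.
set q1 := ((word T)^-1 * word S)%g.
set q2 := ((word T)^-1 * (tperm ord0 i1 * word S))%g.
have q12 : q1 != q2.
  apply/eqP => /mulgI /(congr1 (fun p : 'S_n.+1 => p ord0)).
  by rewrite permM tpermL => /perm_inj /eqP; rewrite eq_sym (negPf i1_neq0).
have ->: polytabloid T (tabloid_of S) =
    \sum_(p in column_stab T) ((-1) ^+ p * (p == q1)%:R + (-1) ^+ p * (p == q2)%:R).
  rewrite /polytabloid sum_ffunE; apply: eq_bigr => p _.
  rewrite !ffunE tabloid_act_of eq_sym tabloid_of_eq word_act -mulrDr.
  rewrite -[_ *: _]/(_ * _); congr (_ * _).
  have mulE q : (word T * p == q)%g = (p == (word T)^-1 * q)%g.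
    by apply/eqP/eqP => [<-|->]; rewrite ?mulKg ?mulKVg.
  rewrite !mulE -/q1 -/q2; case: (p =P q1) => [->|_]; last by rewrite add0r.
  by rewrite (negPf q12) addr0.
rewrite big_split !sum_at /= !permM !permK tpermR !odd_permM odd_permV.
rewrite odd_tperm [ord0 == i1]eq_sym i1_neq0 !signr_addb expr1.
rewrite [word S i1 == _]eq_sym [word S ord0 == _]eq_sym.
by rewrite mulN1r mulrN mulNr -mulrBr.
Qed.

Lemma tabloidP (X : tabloid) : exists T : tableau, X = tabloid_of T.
Proof.
by have /imsetP[T _ XT] := valP X; exists T; apply: val_inj.
Qed.

Lemma tabloid_actE p (x : {ffun tabloid -> rat^o}) T :
  tabloid_module_act p x (tabloid_of T) = x (tabloid_of (tableau_act p^-1%g T)).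
Proof.
rewrite sum_ffunE (bigD1 (tabloid_of (tableau_act p^-1%g T))) //=.
have actKV S : tableau_act p (tableau_act p^-1%g S) = S.
  by rewrite -{1}[p]invgK tableau_actK.
have termE X : (x X *: tabloid_vec (tabloid_act p X)) (tabloid_of T) =
    x X * (tabloid_of T == tabloid_act p X)%:R by rewrite !ffunE.
rewrite big1 => [|X neX].
  by rewrite addr0 termE tabloid_act_of actKV eqxx mulr1.
rewrite termE; case: eqP => [TX|_]; last by rewrite mulr0.
case/eqP: neX; rewrite -tabloid_act_of TX; have [S ->] := tabloidP X.
by rewrite !tabloid_act_of tableau_actK.
Qed.

Lemma ffun_tabloid_eq (x y : {ffun tabloid -> rat^o}) :
  (forall T, x (tabloid_of T) = y (tabloid_of T)) -> x = y.
Proof. by move=> xy; apply/ffunP => X; have [T ->] := tabloidP X. Qed.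

Lemma tabloid_act_zmod p : zmod_morphism (@tabloid_module_act n.+1 (hook n) p).
Proof. by move=> x y; apply: ffun_tabloid_eq => T; rewrite !ffunE !tabloid_actE !ffunE. Qed.

(** Box [i1] gets [c], and the other letters fill the first column in increasing order. *)
Definition hook_word c : 'S_n.+1 := lift_perm i1 c 1.

(** This is [w_c]: the scalar cancels the sign of the word of the tableau in [polytabloidE], leaving
    a dependence on [c] alone. *)
Definition signed_polytabloid c : {ffun tabloid -> rat^o} :=
  (-1) ^+ hook_word c *: polytabloid (of_word (hook_word c)).

Lemma hook_word1 c : hook_word c i1 = c.
Proof. exact: lift_perm_id. Qed.

Lemma hook_word_lift c k : hook_word c (lift i1 k) = lift c k.
Proof. by rewrite lift_perm_lift perm1. Qed.

Lemma hook_word0 c : c != ord0 -> hook_word c ord0 = ord0.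
Proof.
move=> c0; have ->: ord0 = lift i1 (Ordinal n_gt0) by apply: val_inj; rewrite /= val_i1.
rewrite hook_word_lift; apply: val_inj => /=.
by rewrite /bump leqn0 -[c == 0%N :> nat]/(c == ord0) (negPf c0) val_i1.
Qed.

Lemma signed_polytabloidE c S :
  signed_polytabloid c (tabloid_of S) =
    (-1) ^+ word S * ((c == word S i1)%:R - (c == word S ord0)%:R).
Proof.
rewrite ffunE polytabloidE of_wordK hook_word1 -[_ *: _]/(_ * _) !mulrA.
by rewrite -signr_addb addbb mul1r.
Qed.

Lemma polytabloid_signed T :
  polytabloid T = (-1) ^+ word T *: signed_polytabloid (word T i1).
Proof.
apply: ffun_tabloid_eq => S; rewrite polytabloidE [RHS]ffunE signed_polytabloidE.
by rewrite -[_ *: _]/(_ * _) mulrA.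
Qed.

(** At each tabloid only the two letters of its first row contribute, with opposite signs. *)
Lemma sum_signed_polytabloid : \sum_c signed_polytabloid c = 0.
Proof.
apply: ffun_tabloid_eq => S; rewrite sum_ffunE [RHS]ffunE.
rewrite (eq_bigr _ (fun c _ => signed_polytabloidE c S)) -mulr_sumr sumrB.
rewrite -!natr_sum.
have one k : (\sum_c (c == k :> 'I_n.+1))%N = 1%N.
  by rewrite (bigD1 k) //= eqxx big1 // => c /negPf->.
by rewrite !one subrr mulr0.
Qed.

Lemma tabloid_act_signed g c :
  tabloid_module_act g (signed_polytabloid c) = (-1) ^+ g *: signed_polytabloid (g c).
Proof.
apply: ffun_tabloid_eq => S.
rewrite tabloid_actE [RHS]ffunE [LHS]signed_polytabloidE (signed_polytabloidE (g c) S).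
rewrite word_act -[_ *: _]/(_ * _) odd_permM odd_permV signr_addb.
by rewrite mulrA [_ ^+ word S * _]mulrC !permM !(canF_eq (permK g)).
Qed.

Lemma standard_hook_word c : c != ord0 -> standard (of_word (hook_word c)).
Proof.
move=> c0; apply/'forall_forallP => b b'; rewrite !entryE !of_wordK.
apply/andP; split; apply/implyP => /andP[/eqP].
  rewrite !box_rowE !box_colE => rowbb'.
  case: (box_index b =P i1); case: (box_index b' =P i1) => // b'1 b1 _.
  have b0 : box_index b = ord0.
    apply: val_inj; move: rowbb' b1; rewrite b'1 val_i1 /= => bb'.
    by move/eqP; rewrite -val_eqE /= val_i1; lia.
  by rewrite b0 b'1 hook_word0 // hook_word1 lt0n.
rewrite !box_rowE !box_colE.
case: (unliftP i1 (box_index b)) => [k ->|->]; last first.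
  by rewrite eqxx; case: eqP => // -> _; rewrite ltnn.
case: (unliftP i1 (box_index b')) => [k' ->|->]; last first.
  by rewrite eqxx eq_sym (negPf (neq_lift _ _)).
rewrite !hook_word_lift /= /bump !val_i1; lia.
Qed.

(** For [c] nonzero, [w_c] is up to sign a standard polytabloid; [w_0] is minus the sum of the
    others. *)
Lemma specht_latticeE x :
  @specht_lattice n.+1 (hook n) x <-> zspan signed_polytabloid x.
Proof.
apply: inIntSpan_zspan => [y /mapP[T _ ->]|c].
  by rewrite polytabloid_signed signrZ_mulrz; apply/zspanMz/zspan_gen.
have in_span b : b != ord0 ->
  inIntSpan (in_tuple [seq polytabloid T | T <- enum tableau & standard T])
    (signed_polytabloid b).
  move=> b0; rewrite /signed_polytabloid signrZ_mulrz.
  apply/inIntSpan_seqP/zspanMz/inIntSpan_seqP/inIntSpan_mem/map_f.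
  by rewrite mem_filter standard_hook_word // mem_enum.
have [->|/in_span//] := eqVneq c ord0.
have /eqP := sum_signed_polytabloid; rewrite (bigD1 ord0) //= addr_eq0 => /eqP ->.
apply/inIntSpan_seqP; rewrite -mulrN1z; apply/zspanMz/zspan_sum => b /in_span.
by move/inIntSpan_seqP.
Qed.

(** For [c] nonzero, this restricts on the Specht module to the coordinate along [w_c] in the basis
    of the [w_b] with [b] nonzero. *)
Definition hook_coord c (x : {ffun tabloid -> rat^o}) : rat :=
  (-1) ^+ hook_word c * x (tabloid_of (of_word (hook_word c))).

Lemma hook_coord_zmod c : zmod_morphism (hook_coord c).
Proof. by move=> x y; rewrite /hook_coord !ffunE mulrBr. Qed.

Lemma hook_coord_signed c b : c != ord0 ->
  hook_coord c (signed_polytabloid b) = (b == c)%:R - (b == ord0)%:R.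
Proof.
move=> c0; rewrite /hook_coord signed_polytabloidE of_wordK hook_word1.
by rewrite hook_word0 // mulrA -signr_addb addbb mul1r.
Qed.

(** The coordinate at [c] of the combination with coefficients [z] is [z c - z ord0]; if all of
    these vanish, [z] is constant and the relation [sum_signed_polytabloid] applies. *)
Lemma zspan_hook_coord0 x :
  zspan signed_polytabloid x -> (forall c, c != ord0 -> hook_coord c x = 0) -> x = 0.
Proof.
move=> [z ->] z0; have zE c : z c = z ord0.
  have [->//|c0] := eqVneq c ord0.
  pose F : {additive {ffun tabloid -> rat^o} -> rat} :=
    HB.pack (hook_coord c) (GRing.isZmodMorphism.Build _ _ _ (hook_coord_zmod c)).
  have := z0 c c0; rewrite -[LHS]/(F _) raddf_sum.
  under eq_bigr => b _ do rewrite raddfMz /= hook_coord_signed // mulrzBl.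
  rewrite sumrB (bigD1 c) //= big1 => [|b /negPf->]; last by rewrite mul0rz.
  rewrite (bigD1 ord0) //= big1 => [|b /negPf->]; last by rewrite mul0rz.
  by rewrite !eqxx !addr0 => /subr0_eq/intr_inj.
rewrite (eq_bigr (fun c => signed_polytabloid c *~ z ord0)) => [|c _]; last by rewrite zE.
by rewrite -mulrz_suml sum_signed_polytabloid mul0rz.
Qed.

End HookTableaux.

(** * Craig weights: action, linear relations and integral span *)

Section CraigWeights.
Variable n : nat.

Lemma adj_tpermE k (c : 'I_n.+1) : (1 <= k <= n)%N ->
  adj_tperm n k c =
    (if c == k.-1 :> nat then k else if c == k :> nat then k.-1 else c) :> nat.
Proof.
move=> /andP[k1 kn]; rewrite /adj_tperm.
have vk : (inord k : 'I_n.+1) = k :> nat by rewrite inordK.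
have vk1 : (inord k.-1 : 'I_n.+1) = k.-1 :> nat by rewrite inordK //; lia.
case: tpermP => [->|->|/eqP + /eqP]; rewrite ?vk ?vk1 ?eqxx //.
  by case: eqP => //; lia.
by rewrite -!val_eqE /= vk vk1 => /negPf-> /negPf->.
Qed.

(** Conjugating by adjacent transpositions, which are their own inverses, builds all transpositions
    by induction on the distance [d]. *)
Lemma adj_tperm_ind (P : 'S_n.+1 -> Prop) :
    P 1%g -> (forall s t, P s -> P t -> P (s * t)%g) ->
    (forall k, (1 <= k <= n)%N -> P (adj_tperm n k)) ->
  forall g, P g.
Proof.
move=> P1 PM Padj.
have Ptperm i d : (i + d <= n)%N -> P (tperm (inord i) (inord (i + d))).
  elim: d => [|d IHd] le_n; first by rewrite addn0 tperm1.
  (* Distance 1 is treated apart because the conjugation below needs [i] and [i + d] distinct. *)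
  have [d0|d0] := posnP d.
    by have := Padj i.+1; rewrite /adj_tperm d0 addn1 /=; apply; lia.
  have := Padj (i + d).+1; rewrite /adj_tperm /= -addnS => Pd.
  have -> : tperm (inord i) (inord (i + d.+1)) =
      (tperm (inord i) (inord (i + d)) ^ tperm (inord (i + d)) (inord (i + d.+1)) : 'S_n.+1)%g.
    by rewrite tpermJ tpermL tpermD // -val_eqE /= !inordK; lia.
  rewrite /conjg tpermV; have {}Pd : P (tperm (inord (i + d)) (inord (i + d.+1))) by apply: Pd; lia.
  by apply: (PM) => //; apply: (PM) => //; apply: IHd; lia.
move=> g; have [ts -> _] := prod_tpermP g; apply: big_ind => // -[x y] _ /=.
wlog xy : x y / (x <= y)%N.
  by move=> Pxy; case: (leqP x y) => [/Pxy//|/ltnW/Pxy]; rewrite tpermC.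
by have := Ptperm x (y - x)%N; rewrite subnKC // !inord_val; apply; have := ltn_ord y.
Qed.

(* Up to the signs relating the basis to the simple roots of A_n, this is
   n + 1 times the c-th coordinate vector minus the sum of all of them. *)
Definition craig_weight (c : 'I_n.+1) : 'rV[rat]_n :=
  \row_j ((-1) ^+ j.+1 * (n.+1%:R * (c < j.+1)%:R - j.+1%:R)).

(* Indices are 1-based, with value 0 outside 1, ..., n. *)
Definition row_coord (i : nat) (x : 'rV[rat]_n) : rat :=
  \sum_(j < n) (j.+1 == i)%:R * x 0 j.

Lemma row_coordZD i (a : rat) x y :
  row_coord i (a *: x + y) = a * row_coord i x + row_coord i y.
Proof.
rewrite /row_coord mulr_sumr -big_split; apply: eq_bigr => j _ /=.
by rewrite !mxE mulrDr mulrCA.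
Qed.

Lemma row_coord_sum (I : finType) i (d : I -> rat) (x : I -> 'rV[rat]_n) :
  row_coord i (\sum_c d c *: x c) = \sum_c d c * row_coord i (x c).
Proof.
apply: (big_ind2 (fun x a => row_coord i x = a)) => [|x1 a1 x2 a2 <- <-|c _].
- by apply: big1 => j _; rewrite mxE mulr0.
- by rewrite -[x1]scale1r row_coordZD mul1r scale1r.
- by rewrite -[_ *: _]addr0 row_coordZD [row_coord i 0]big1 ?addr0 // => j _; rewrite mxE mulr0.
Qed.

(** At [i = 0] and [i = n + 1] the formula gives 0, which agrees with the default value, so the
    extreme generators [k = 1] and [k = n] need no separate treatment. *)
Lemma row_coord_weight i c : (i <= n.+1)%N ->
  row_coord i (craig_weight c) = (-1) ^+ i * (n.+1%:R * (c < i)%:R - i%:R).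
Proof.
move=> le_i; have [/andP[i1 i_n]|i_out] := boolP (1 <= i <= n)%N.
  have lt_i : (i.-1 < n)%N by lia.
  rewrite /row_coord (bigD1 (Ordinal lt_i)) //= big1 => [|j].
    by rewrite mxE /= prednK // eqxx mul1r addr0.
  by rewrite -val_eqE /= => ji; case: eqP => [|_]; [lia | rewrite mul0r].
rewrite /row_coord big1 => [|j _]; last first.
  by case: eqP => [|_]; [have := ltn_ord j; lia | rewrite mul0r].
have [->|->] : (i = 0 \/ i = n.+1)%N by lia.
  by rewrite ltn0 mulr0 subrr mulr0.
by rewrite ltn_ord mulr1 subrr mulr0.
Qed.

Lemma mulmx_adj_mx (x : 'rV[rat]_n) k a :
  (x *m (adj_mx n k)^T) 0 a =
  (a.+1 == k)%:R * (row_coord k.-1 x + 2 * row_coord k x + row_coord k.+1 x) - x 0 a.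
Proof.
rewrite mxE /row_coord.
have -> : x 0 a = \sum_(j < n) (a == j)%:R * x 0 j.
  by rewrite (bigD1 a) //= eqxx mul1r big1 ?addr0 // => j; rewrite eq_sym => /negPf->; rewrite mul0r.
rewrite [2 * _]mulr_sumr -!big_split mulr_sumr -sumrB; apply: eq_bigr => j _ /=.
rewrite !mxE; case: (a.+1 == k) => /=; ring.
Qed.

(** Up to a global sign and the factors [(-1) ^+ j], the matrix replaces coordinate [k] by the sum
    of its neighbours minus itself. This exchanges the increments before and after [k]. The
    increments of [craig_weight c] are all -1 except for a jump [n] from [c] to [c + 1], so only the
    position of the jump moves. *)
Lemma mulmx_weight_adj c k : (1 <= k <= n)%N ->
  craig_weight c *m (adj_mx n k)^T = - craig_weight (adj_tperm n k c).
Proof.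
move=> k1n; apply/rowP => a; rewrite mulmx_adj_mx !row_coord_weight; try lia.
rewrite !mxE adj_tpermE //.
(* Away from [k] nothing changes but the sign: only the threshold [k] separates the letters [k - 1]
   and [k]. *)
case: eqP => [<-|ak]; last first.
  rewrite mul0r sub0r; congr (- (_ * (_ * (nat_of_bool _)%:R - _))).
  by case: ifP => [/eqP ?|_]; last (case: ifP => [/eqP ?|_] //); lia.
rewrite mul1r /= !exprS !mulN1r !mulNr !opprK.
rewrite -![a.+1%:R]natr1 -![a.+2%:R]natr1 -![a.+1%:R]natr1.
case: (ltngtP c a) => [ca|ca|ca].
- have -> : (c < a.+1)%N by lia.
  have -> : (c < a.+2)%N by lia.
  have -> : (c == a.+1 :> nat) = false by lia.
  have -> : (c < a.+1)%N by lia.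
  ring.
- have -> : (c < a.+1)%N = false by lia.
  have [ca1|ca1] := eqVneq (c : nat) a.+1.
    by rewrite ca1 !ltnSn; ring.
  have -> : (c < a.+2)%N = false by lia.
  have -> : (c < a.+1)%N = false by lia.
  ring.
- by rewrite ca ltnSn ltnn ltnS leqnSn; ring.
Qed.

Lemma craig_weight_free (d : 'I_n.+1 -> rat) :
  \sum_c d c *: craig_weight c = 0 -> forall c, d c = d ord0.
Proof.
move=> d0 c.
have diff (b : 'I_n.+1) : n.+1%:R * d b = \sum_c d c.
  have coord0 i : (i <= n.+1)%N ->
      \sum_c d c * (n.+1%:R * (c < i)%:R - i%:R) = 0.
    move=> le_i; have := row_coord_sum i d craig_weight; rewrite d0 [LHS]big1 => [/esym|j _].
      under eq_bigr do rewrite row_coord_weight // mulrCA.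
      by rewrite -mulr_sumr => /eqP; rewrite mulf_eq0 signr_eq0 => /eqP.
    by rewrite mxE mulr0.
  (* Subtracting the equation at [b] from that at [b + 1] isolates [d b]; the extreme values 0 and
     [n + 1] of the index are included. *)
  have := subrr (0 : rat).
  rewrite -[X in X - _](coord0 b.+1 (ltn_ord b)) -[X in _ - X](coord0 b (ltnW (ltn_ord b))).
  rewrite -sumrB; under eq_bigr do rewrite -mulrBr.
  rewrite (eq_bigr (fun c => n.+1%:R * (d c * (c == b)%:R) - d c)) => [|k _].
    rewrite sumrB -mulr_sumr (bigD1 b) //= eqxx mulr1 big1 ?addr0 => [|k /negPf->].
      by move/eqP; rewrite subr_eq0 => /eqP.
    by rewrite mulr0.
  rewrite ltnS -[(b.+1)%:R]natr1 -val_eqE; case: ltngtP => _ /=; ring.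
have n0 : n.+1%:R != 0 :> rat by rewrite pnatr_eq0.
by apply: (mulfI n0); rewrite !diff.
Qed.

Lemma sum_craig_weight : \sum_c craig_weight c = 0.
Proof.
apply/rowP => j; rewrite summxE [RHS]mxE.
under eq_bigr do rewrite mxE.
rewrite -mulr_sumr sumrB -mulr_sumr sumr_const card_ord -natr_sum.
rewrite -big_mkcond /= -(big_ord_widen n.+1 (fun=> 1%N)) //.
  by rewrite sum1_card card_ord mulr_natl subrr mulr0.
by rewrite ltnS; apply: ltnW.
Qed.

Lemma craig_weight_diff i : (1 <= i <= n)%N ->
  n.+1%:R *: basis_vec n i =
  (-1) ^+ i *: (craig_weight (inord i.-1) - craig_weight (inord i)).
Proof.
move=> /andP[i1 i_n]; apply/rowP => a; rewrite !mxE !inordK; try lia.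
case: eqP => [<-|ai]; last first.
  have -> : (i.-1 < a.+1)%N = (i < a.+1)%N by lia.
  by rewrite subrr !mulr0.
rewrite -mulrBr signrMK ltnSn ltnn /=; ring.
Qed.

(** The letter [n - 1] lies below the threshold [n] only, so the unsigned coordinates are [- j] for
    [j < n], and [n + 1 - n = 1] at [n]. *)
Lemma craig_vE : (0 < n)%N -> craig_v n = (-1) ^+ n *: craig_weight (inord n.-1).
Proof.
move=> n0; apply/rowP => a; rewrite !mxE inordK; last by lia.
rewrite summxE.
have [an|an] := ltnP a.+1 n.
  rewrite (bigD1_seq a.+1) ?iota_uniq ?mem_index_iota //=.
  rewrite big1 => [|i ia]; last by rewrite !mxE eq_sym (negPf ia) mulr0.
  rewrite !mxE eqxx; have -> : (a.+1 == n) = false by lia.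
  have -> : (n.-1 < a.+1)%N = false by lia.
  have -> : (-1) ^+ n = (-1) ^+ (n - a) * (-1) ^+ a :> rat.
    by rewrite -exprD subnK //; lia.
  rewrite subSS exprS mulN1r mulNr mulrN -[in RHS]mulrA signrMK /=; ring.
rewrite big_nat big1 => [|i /andP[_ i_n]]; last first.
  by rewrite !mxE; case: eqP => [|_]; [lia | rewrite mulr0].
have {an} an : a.+1 = n by have := ltn_ord a; lia.
by rewrite an signrMK prednK // leqnn eqxx mulr1 -natrB // subSnn addr0.
Qed.

Lemma craig_latticeE x : (0 < n)%N ->
  @craig_lattice n n.+1 x <-> zspan craig_weight x.
Proof.
move=> n0.
apply: inIntSpan_zspan => [y|c].
  rewrite mem_rcons inE => /predU1P[->|/mapP[i]].
    by rewrite craig_vE // signrZ_mulrz; apply/zspanMz/zspan_gen.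
  rewrite mem_iota => i1 ->; rewrite craig_weight_diff; last by lia.
  rewrite signrZ_mulrz; apply/zspanMz/zspanD; first exact: zspan_gen.
  by rewrite -mulrN1z; apply/zspanMz/zspan_gen.
apply/inIntSpan_seqP.
set s := rcons _ _; pose w (i : 'I_(size s)) := s`_i.
have in_s y : y \in s -> zspan w y by move=> ys; apply/inIntSpan_seqP/inIntSpan_mem.
(* Starting from [v], which gives letter [n - 1], the differences [(n + 1) e_i] lead down to letter
   0. Letter [n] is left to the relation [sum_craig_weight], since no multiple of [e_n] is listed
   among the generators. *)
have in_lt d : (d < n)%N -> zspan w (craig_weight (inord (n.-1 - d))).
  elim: d => [|d IHd] lt_d.
    rewrite subn0 -[craig_weight _](signrZK n) -craig_vE // signrZ_mulrz.
    by apply/zspanMz/in_s; rewrite mem_rcons mem_head.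
  have -> : craig_weight (inord (n.-1 - d.+1)) =
      (-1) ^+ (n.-1 - d)%N *: (n.+1%:R *: basis_vec n (n.-1 - d)%N) +
      craig_weight (inord (n.-1 - d)%N).
    rewrite craig_weight_diff; last by lia.
    by rewrite signrZK subnS subrK.
  apply: zspanD; last by apply: IHd; lia.
  rewrite signrZ_mulrz; apply/zspanMz/in_s; rewrite mem_rcons inE; apply/orP; right.
  by apply/mapP; exists (n.-1 - d)%N => //; rewrite mem_iota; lia.
have in_w (b : 'I_n.+1) : b != ord_max -> zspan w (craig_weight b).
  rewrite -val_eqE /= => bn; have ltb := ltn_ord b.
  have -> : b = inord (n.-1 - (n.-1 - b)) by apply: val_inj; rewrite /= inordK; lia.
  by apply: in_lt; lia.
have [->|/in_w//] := eqVneq c ord_max.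
have /eqP := sum_craig_weight; rewrite (bigD1 ord_max) //= addr_eq0 => /eqP ->.
by rewrite -mulrN1z; apply/zspanMz/zspan_sum.
Qed.

Lemma craig_act_weight (rG : mx_representation rat [set: 'S_n.+1] n) g c :
  craig_repr rG -> craig_act rG g (craig_weight c) = (-1) ^+ g *: craig_weight (g c).
Proof.
move=> hrG; rewrite /craig_act; elim/adj_tperm_ind: g c => [|s t IHs IHt|k k1n] c.
- by rewrite repr_mx1 mulmx1 odd_perm1 scale1r perm1.
- rewrite repr_mxM ?inE // mulmxA IHs -scalemxAl IHt scalerA -signr_addb.
  by rewrite odd_permM permM.
rewrite hrG // mulmx_weight_adj //.
have -> : odd_perm (adj_tperm n k) = true.
  by rewrite odd_tperm -val_eqE /= !inordK; lia.
by rewrite expr1 scaleN1r.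
Qed.

End CraigWeights.

Theorem proposition20 (n : nat) (hn : (2 <= n)%N)
    (rG : mx_representation rat [set: 'S_n.+1] n) (hrG : craig_repr rG) :
  ZG_isomorphic
    (@tabloid_module_act n.+1 (hook n)) (@specht_lattice n.+1 (hook n))
    (craig_act rG) (@craig_lattice n n.+1).
Proof.
have n0 : (0 < n)%N by lia.
(* Expanding along the [w_c] with [c] nonzero defines the map on the whole permutation module. *)
pose f x : 'rV[rat]_n := \sum_(c | c != ord0) hook_coord n0 c x *: craig_weight c.
apply: (@ZG_isomorphic_zspan {perm 'I_n.+1} 'I_n.+1 _ _ _ _ _ _
  (signed_polytabloid n0) (@craig_weight n) (fun g => g) (fun g => (-1) ^+ g) f).
- by move=> x; apply: specht_latticeE.
- by move=> x; apply: craig_latticeE.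
- exact: tabloid_act_zmod.
- by move=> g x y; apply: mulmxBl.
- by move=> g c; rewrite tabloid_act_signed signrZ_mulrz.
- by move=> g c; rewrite craig_act_weight // signrZ_mulrz.
- move=> x y; rewrite /f -sumrB; apply: eq_bigr => c _.
  by rewrite hook_coord_zmod scalerBl.
- move=> b; rewrite /f (eq_bigr (fun c => ((b == c)%:R - (b == ord0)%:R) *: craig_weight c)).
    (* All coordinates of [w_0] are -1, and [u_0] is minus the sum of the other weights. *)
    have [->|b0] := eqVneq b ord0.
      have /eqP := sum_craig_weight n; rewrite (bigD1 ord0) //= addr_eq0 => /eqP ->.
      rewrite -sumrN; apply: eq_bigr => c; rewrite eq_sym => /negPf ->.
      by rewrite sub0r scaleN1r.
    rewrite (bigD1 b) //= eqxx subr0 scale1r big1 ?addr0 // => c /andP[_].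
    by rewrite eq_sym => /negPf->; rewrite subr0 scale0r.
  by move=> c c0; rewrite hook_coord_signed.
move=> x Lx fx0; apply: (@zspan_hook_coord0 n n0); first exact/specht_latticeE.
(* Extending the coefficients by 0 at letter 0 forces their common value to be 0. *)
pose d c := if c == ord0 then 0 else hook_coord n0 c x.
have dE : \sum_c d c *: craig_weight c = 0.
  rewrite -[RHS]fx0 /f [RHS]big_mkcond; apply: eq_bigr => c _.
  by rewrite /d; case: eqP; rewrite ?scale0r.
by move=> c c0; have := craig_weight_free dE c; rewrite /d eqxx (negPf c0).
Qed.
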